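(* As $D\to\infty$, for every $3$-uniform $2$-simple hypergraph $\mathcal{H}$ with maximum degree at most $D$ and every edge $e\in E(\mathcal{H})$, $$b_{L(\mathcal{H}),\,3D}(e)\le 1-\frac{2}{9}+\frac{2}{3^5}+o(1),$$ where the $o(1)$ term depends only on $D$ and tends to $0$ as $D\to\infty$.
   Context: A hypergraph $\mathcal{H}$ consists of a vertex set $V(\mathcal{H})$ and a multiset $E(\mathcal{H})$ of edges, each a subset of $V(\mathcal{H})$ (copies of a repeated edge count as distinct edges). It is $k$-uniform if every edge has size $k$, and $t$-simple if every two distinct edges intersect in at most $t$ vertices. The degree of a vertex is the number of edges (with multiplicity) containing it. The line graph $L(\mathcal{H})$ is the simple graph whose vertices are the edges of $\mathcal{H}$ (with multiplicity), two distinct edges being adjacent iff they intersect. For a graph $G$ and $v\in V(G)$, let $P_G(v):=\binom{\deg_G(v)}{2}-|E(N_G(v))|$ be the number of non-adjacent (unordered) pairs of distinct vertices in $N_G(v)$, where $E(N_G(v))$ is the set of edges of $G$ with both ends in $N_G(v)$, and let $T_G(v)$ be the number of $3$-element subsets of $N_G(v)$ that are pairwise non-adjacent in $G$. For a number $M\ge\Delta(G)$, define $$b_{G,M}(v):=\frac{\deg_G(v)}{M}-\frac{P_G(v)}{M^2}+\frac{T_G(v)}{M^3}.$$ *)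

(* Defs.v *)
From mathcomp Require Import all_boot all_order all_algebra.

Set Implicit Arguments.
Unset Strict Implicit.
Unset Printing Implicit Defensive.

Import GRing.Theory.

(* The multiset of edges is the family of the sets [ends e], indexed by a
   finite type of edges: repeated edges are distinct indices with the same
   [ends]. *)
Record hypergraph := Hypergraph {
  hvertex : finType;
  hedge : finType;
  ends : hedge -> {set hvertex}
}.

Definition uniform (k : nat) (H : hypergraph) : Prop :=
  forall e : hedge H, #|ends e| = k.

Definition simple_hypergraph (t : nat) (H : hypergraph) : Prop :=
  forall e f : hedge H, e != f -> #|ends e :&: ends f| <= t.

Definition hdegree (H : hypergraph) (x : hvertex H) : nat :=
  #|[set e : hedge H | x \in ends e]|.

Definition max_hdegree (H : hypergraph) : nat :=
  \max_(x : hvertex H) hdegree x.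

Record sgraph := SGraph {
  svertex :> finType;
  adj : rel svertex;
  adj_sym : symmetric adj;
  adj_irrefl : irreflexive adj
}.

Section LineGraph.
Variable H : hypergraph.

Definition line_adj : rel (hedge H) :=
  fun e f => (e != f) && (ends e :&: ends f != set0).

Lemma line_adj_sym : symmetric line_adj.
Proof. by move=> e f; rewrite /line_adj eq_sym setIC. Qed.

Lemma line_adj_irrefl : irreflexive line_adj.
Proof. by move=> e; rewrite /line_adj eqxx. Qed.

Definition line_graph : sgraph := SGraph line_adj_sym line_adj_irrefl.

End LineGraph.

Section LocalCounts.
Variable G : sgraph.
Implicit Types (v x y : G) (S A : {set G}).

Definition nbhd v : {set G} := [set x | adj v x].

Definition degree v : nat := #|nbhd v|.

Definition edges : {set {set G}} :=
  [set A : {set G} | [exists x, [exists y, adj x y && (A == [set x; y])]]].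

Definition edges_in S : {set {set G}} := [set A in edges | A \subset S].

Definition pairwise_nonadj A : bool :=
  [forall x in A, [forall y in A, (x != y) ==> ~~ adj x y]].

(* The subtraction never truncates: see [nonadj_pairsE]. *)
Definition nonadj_pairs v : nat := 'C(degree v, 2) - #|edges_in (nbhd v)|.

Definition nonadj_triples v : nat :=
  #|[set A : {set G} | [&& A \subset nbhd v, #|A| == 3 & pairwise_nonadj A]]|.

Lemma edges_in_card2 S :
  edges_in S \subset [set A : {set G} | A \subset S & #|A| == 2].
Proof.
apply/subsetP => A; rewrite !inE => /andP[/existsP[x /existsP[y]]].
case/andP => xy /eqP-> ->; rewrite cards2.
by case: (eqVneq x y) xy => // ->; rewrite adj_irrefl.
Qed.

Lemma edges_in_le v : #|edges_in (nbhd v)| <= 'C(degree v, 2).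
Proof. by rewrite -cards_draws; apply/subset_leq_card/edges_in_card2. Qed.

Lemma nonadj_pairsE v :
  nonadj_pairs v =
  #|[set A : {set G} | [&& A \subset nbhd v, #|A| == 2 & pairwise_nonadj A]]|.
Proof.
rewrite /nonadj_pairs -cards_draws -cardsDS ?edges_in_card2 //.
apply: eq_card => A; rewrite !inE.
have [AN|] := boolP (A \subset nbhd v); rewrite ?andbF //= andbT.
case: cards2P => [[x [y [xy ->]]]|_]; last by rewrite andbF.
rewrite andbT /=.
have sxy : adj x y = adj y x by rewrite adj_sym.
apply/idP/idP => [/existsPn nE | /forall_inP nA].
  have nxy : ~~ adj x y.
    by move: (nE x) => /existsPn/(_ y); rewrite eqxx andbT.
  apply/forall_inP => a /set2P[]->; apply/forall_inP => b /set2P[]->;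
    by rewrite ?eqxx -?sxy ?nxy ?implybT.
have nxy : ~~ adj x y.
  have /forall_inP/(_ y (set22 _ _)) := nA x (set21 _ _).
  by rewrite xy.
apply/existsPn => a; apply/existsPn => b; apply/negP => /andP[ab /eqP E].
have /set2P[ax|ax] : a \in [set x; y] by rewrite E set21.
all: have /set2P[bx|bx] : b \in [set x; y] by rewrite E set22.
all: by move: ab; rewrite ax bx ?adj_irrefl -?sxy ?(negPf nxy).
Qed.

End LocalCounts.

Local Open Scope ring_scope.

Definition b_fun (R : realFieldType) (G : sgraph) (M : R) (v : G) : R :=
  (degree v)%:R / M - (nonadj_pairs v)%:R / M ^+ 2
  + (nonadj_triples v)%:R / M ^+ 3.

(* Main.v *)
Require Import Defs.
From mathcomp Require Import all_classical all_reals all_analysis.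
From mathcomp Require Import all_boot all_order all_algebra.
From mathcomp Require Import zify ring lra.

Import Order.TTheory GRing.Theory Num.Theory.
Import numFieldNormedType.Exports.

Set Implicit Arguments.
Unset Strict Implicit.
Unset Printing Implicit Defensive.

(** Let [e] have the vertices [x], [y], [z].  Two-simplicity and three-uniformity
    make an edge determined by three of its vertices, so a neighbour of [e]
    meets [e] either in one vertex [t] ([meets_at t]) or in the two vertices
    other than [t] ([meets_off t]).  Two neighbours with a common vertex in [e]
    are adjacent, so the non-adjacent pairs join [meets_at s] to [meets_at t]
    with [s != t], or [meets_off t] to [meets_at t], and a non-adjacent triple
    takes one edge from each [meets_at t].

    The crucial point is that edges of different classes [meets_at t] are, up
    to o(D^2) pairs, adjacent exactly when they have the same hub.  The load
    of a vertex outside [e] is the number of edges through it that meet [e] in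
    one vertex; such an edge has two vertices outside [e], and its hub is one
    of larger load.  Two edges may also meet in a vertex that is not the hub
    of one of them, but this is rare.  If [w] is the non-hub vertex of [n]
    edges of [meets_at t], then the hubs of these edges are distinct, each has
    load at least [n], and all the loads add up to at most [6D]; hence
    [n ^ 2 <= 6D] ([light_sq]), and only O(D^(3/2)) pairs of edges meet in a
    non-hub vertex.  Likewise only O(D) pairs of [meets_off t] and [meets_at t]
    are adjacent.

    What remains is an optimisation problem.  Put the sizes of the classes and
    the numbers of pairs and triples with a common hub in units of D, D^2
    and D^3.  At most D edges have a given hub, so by the inequality of the
    means the pairs with a common hub number at most D^2 and the triples at
    most D^3/9 ([same_hub_le], [same_hub3_le]); both are attained by three
    hubs carrying D/3 edges of each class.  Inserting this into the lower
    bound for the pairs ([nonadj_pairs_hub]) and the upper bound for the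
    triples ([nonadj_triples_hub]) leaves a polynomial inequality in the class
    sizes, [local_density], which is sharp when every [meets_at t] has D edges
    and the two bounds for common hubs are attained. *)

(** * Counting and the inequality of the means *)

Lemma card_nsum_bool (T : finType) (P : pred T) :
  #|[set x | P x]| = \sum_x P x.
Proof.
rewrite -sum1dep_card [LHS]big_mkcond; apply: eq_bigr => x _.
by case: (P x).
Qed.

Lemma card_sum_mem (T : finType) (A : {set T}) : #|A| = \sum_x (x \in A).
Proof. by rewrite -card_nsum_bool; apply: eq_card => x; rewrite inE. Qed.

Lemma card_sum_bool (T : finType) (A : {pred T}) (P : pred T) :
  #|[set x in A | P x]| = \sum_(x in A) P x.
Proof.
rewrite -sum1dep_card [LHS]big_mkcondr; apply: eq_bigr => x _.
by case: (P x).
Qed.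

Lemma card3P (T : finType) (A : {set T}) : #|A| = 3 ->
  exists a b c, [/\ a != b, a != c, b != c & A = [set a; b; c]].
Proof.
move=> A3; have /card_gt0P[a aA] : 0 < #|A| by rewrite A3.
have : #|A :\ a| == 2 by have := cardsD1 a A; rewrite aA A3; lia.
case/cards2P => b [c [bc E]]; exists a, b, c.
have : b \in A :\ a by rewrite E set21.
have : c \in A :\ a by rewrite E set22.
rewrite !inE ![_ == a]eq_sym => /andP[-> _] /andP[-> _]; rewrite bc; split=> //.
by rewrite -setUA -E setD1K.
Qed.

Lemma double_mul_le p q : 2 * (p * q) <= p * p + q * q.
Proof. by rewrite !mulnn nat_Cauchy. Qed.

Lemma amgm2 p q r : 3 * (p * q + q * r + p * r) <= (p + q + r) * (p + q + r).
Proof.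
have := double_mul_le p q; have := double_mul_le q r; have := double_mul_le p r; lia.
Qed.

Lemma amgm3 p q r : 27 * (p * (q * r)) <= (p + q + r) ^ 3.
Proof.
have K a b c := leq_mul (leqnn c) (double_mul_le a b).
have := K p q r; have := K q r p; have := K p r q.
have := K p q (p + q); have := K q r (q + r); have := K p r (p + r).
rewrite !expnS expn0; lia.
Qed.

(** * The neighbours of an edge *)

Section Neighbourhood.
Variables (H : hypergraph) (D : nat) (e : hedge H).
Hypotheses (H3 : uniform 3 H) (H2 : simple_hypergraph 2 H).
Hypothesis (HD : max_hdegree H <= D).
Implicit Types (f g h : hedge H) (t s v w : hvertex H) (A : {set hvertex H}).

Lemma hdegree_le w : hdegree w <= D.
Proof. by apply: leq_trans HD; apply: leq_bigmax. Qed.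

(** The only form in which two-simplicity is used. *)
Lemma edge_unique A f g :
  2 < #|A| -> A \subset ends f -> A \subset ends g -> f = g.
Proof.
move=> A3 Af Ag; apply/eqP/negPn/negP => /H2; apply/negP; rewrite -ltnNge.
by apply: leq_trans A3 _; apply: subset_leq_card; rewrite subsetI Af.
Qed.

Definition meets_at t : {set hedge H} := [set f | ends f :&: ends e == [set t]].
Definition meets_off t : {set hedge H} :=
  [set f | ends f :&: ends e == ends e :\ t].
Definition spokes : {set hedge H} := [set f | #|ends f :&: ends e| == 1].
Definition outside f := ends f :\: ends e.
(** Only the edges meeting [e] in one vertex are counted, so that the loads
    sum to [2 * #|spokes|]. *)
Definition load w := #|[set f in spokes | w \in outside f]|.

Lemma meets_at_spoke t f : f \in meets_at t -> f \in spokes.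
Proof. by rewrite !inE => /eqP ->; rewrite cards1. Qed.

Lemma meets_atP t f : f \in meets_at t -> t \in ends f /\ t \in ends e.
Proof.
rewrite inE => /eqP E; have : t \in ends f :&: ends e by rewrite E set11.
by rewrite inE => /andP.
Qed.

Lemma card_outside f : f \in spokes -> #|outside f| = 2.
Proof.
by rewrite inE => /eqP E; rewrite cardsD E H3.
Qed.

Lemma load_le_hdegree w : load w <= hdegree w.
Proof.
apply: subset_leq_card; apply/subsetP => f; rewrite !inE.
by case/and3P.
Qed.

(** Each spoke uses up one unit of the degree of a vertex of [e]. *)
Lemma card_spokes : #|spokes| <= 3 * D.
Proof.
have -> : #|spokes| = \sum_(f in spokes) \sum_(t in ends e) (t \in ends f).
  rewrite -sum1_card; apply: eq_bigr => f; rewrite inE => /eqP <-.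
  by rewrite -card_sum_bool; apply: eq_card => t; rewrite !inE andbC.
rewrite exchange_big /= -(H3 e) -sum_nat_const; apply: leq_sum => t _.
rewrite -card_sum_bool; apply: leq_trans (hdegree_le t).
by apply: subset_leq_card; apply/subsetP => f; rewrite !inE => /andP[].
Qed.

Lemma sum_load : \sum_w load w <= 6 * D.
Proof.
under eq_bigr do rewrite /load card_sum_bool.
rewrite exchange_big /=.
under eq_bigr => f fF do
  rewrite -card_nsum_bool cardsE (card_outside fF).
rewrite sum_nat_const; have := card_spokes; lia.
Qed.

(** * Hubs *)

Definition is_hub f w :=
  (w \in outside f) && [forall v in outside f, load v <= load w].

(** The edges that are not spokes may be sent to any vertex at all; some
    vertex exists because [e] is not empty. *)
Lemma hub_exists : exists hub : hedge H -> hvertex H,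
  {in spokes, forall f, is_hub f (hub f)}.
Proof.
apply: (@fin_all_exists _ (fun=> hvertex H) (fun f w => f \in spokes -> is_hub f w)).
move=> f; have [fF|_] := boolP (f \in spokes); last first.
  have /card_gt0P[w _] : 0 < #|ends e| by rewrite H3.
  by exists w.
have /card_gt0P[w0 w0f] : 0 < #|outside f| by rewrite card_outside.
exists [arg max_(w > w0 in outside f) load w] => _; case: arg_maxnP => // w wf le_w.
by rewrite /is_hub wf; apply/forall_inP => v /le_w.
Qed.

Variable hub : hedge H -> hvertex H.
Hypothesis hubP : {in spokes, forall f, is_hub f (hub f)}.

Lemma hub_outside f : f \in spokes -> hub f \in outside f.
Proof. by move/hubP => /andP[]. Qed.

Lemma load_hub f w : f \in spokes -> w \in outside f -> load w <= load (hub f).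
Proof. by move/hubP => /andP[_ /forall_inP]; apply. Qed.

(** The edges of [meets_at t] that contain [w] outside [e], but as the lighter
    of their two outside vertices. *)
Definition light t w : {set hedge H} :=
  [set f in meets_at t | (w \in outside f) && (w != hub f)].

(** An edge of [light t w] consists of [t], [w] and its hub. *)
Lemma hub_inj_light t w : {in light t w &, injective hub}.
Proof.
move=> f g; rewrite [f \in _]inE [g \in _]inE.
move=> /and3P[ft wf wNf] /and3P[gt wg wNg] Ehub.
have [tf te] := meets_atP ft; have [tg _] := meets_atP gt.
have := hub_outside (meets_at_spoke ft); have := hub_outside (meets_at_spoke gt).
rewrite -Ehub !in_setD => /andP[hNe hg] /andP[_ hf].
move: wf wg; rewrite !in_setD => /andP[wNe wf] /andP[_ wg].
apply: (@edge_unique (t |: (w |: [set hub f]))).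
- rewrite !cardsU1 cards1 !inE wNf.
  have -> : t == w = false by apply/eqP => E; rewrite -E te in wNe.
  by have -> : t == hub f = false by apply/eqP => E; rewrite -E te in hNe.
- by rewrite !subUset !sub1set tf wf.
- by rewrite !subUset !sub1set tg wg.
Qed.

Lemma light_le_load t w : #|light t w| <= load w.
Proof.
apply: subset_leq_card; apply/subsetP => f.
rewrite [f \in light _ _]inE => /and3P[ft wf _].
by rewrite inE wf (meets_at_spoke ft).
Qed.

(** With [n] edges in [light t w], the vertex [w] has load at least [n]; so
    have the [n] hubs of these edges, which are no lighter than [w] and are
    distinct.  Their loads, at least [n ^ 2] altogether, are bounded by the
    total load. *)
Lemma light_sq t w : #|light t w| ^ 2 <= 6 * D.
Proof.
apply: leq_trans sum_load.
apply: (@leq_trans (\sum_(f in light t w) load (hub f))).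
  rewrite -mulnn -sum_nat_const; apply: leq_sum => f.
  rewrite inE => /and3P[ft wf _]; apply: leq_trans (light_le_load t w) _.
  exact: load_hub (meets_at_spoke ft) wf.
rewrite -(big_imset load (@hub_inj_light t w)).
rewrite [leqRHS](bigID [in [set hub f | f in light t w]]) /=.
exact: leq_addr.
Qed.

Definition same_hub s t :=
  \sum_(f in meets_at s) \sum_(g in meets_at t) (hub f == hub g).
(** An upper bound for the number of pairs of spokes, the first in
    [meets_at t], that share an outside vertex other than the hub of the
    first. *)
Definition light_pairs t := \sum_w #|light t w| * load w.

(** A common vertex of the two edges lies outside [e], as their traces on [e]
    are disjoint; it is the hub of both, or else a non-hub vertex of one. *)
Lemma line_adj_meets s t : s != t ->
  \sum_(f in meets_at s) \sum_(g in meets_at t) line_adj f g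
    <= same_hub s t + (light_pairs s + light_pairs t).
Proof.
move=> st.
have lp u v : light_pairs u >= \sum_(f in meets_at u) \sum_(g in meets_at v)
    \sum_w (f \in light u w) * (w \in outside g).
  under eq_bigr do rewrite exchange_big /=.
  rewrite exchange_big /=; apply: leq_sum => w _.
  under eq_bigr do rewrite -big_distrr /=.
  rewrite -big_distrl /= -card_sum_bool; apply: leq_mul.
    by apply: subset_leq_card; apply/subsetP => f; rewrite inE => /andP[].
  rewrite -card_sum_bool; apply: subset_leq_card; apply/subsetP => f.
  by rewrite inE => /andP[fv wf]; rewrite inE (meets_at_spoke fv).
have := lp t s; rewrite exchange_big /= => lpt.
apply: leq_trans (leq_add (leqnn _) (leq_add (lp s t) lpt)).
rewrite -!big_split /=; apply: leq_sum => f fs.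
rewrite -!big_split /=; apply: leq_sum => g gt.
have [/andP[_ /set0Pn[w]]|//] := boolP (line_adj f g).
rewrite inE => /andP[wf wg].
have wNe : w \notin ends e.
  apply/negP => we; move: fs gt; rewrite !inE => /eqP Ef /eqP Eg.
  have : w \in ends f :&: ends e by rewrite inE wf.
  have : w \in ends g :&: ends e by rewrite inE wg.
  by rewrite Ef Eg !inE => /eqP -> /eqP E; rewrite E eqxx in st.
have wof : w \in outside f by rewrite inE wNe.
have wog : w \in outside g by rewrite inE wNe.
have [Eh|Nh] := eqVneq (hub f) (hub g) => //.
rewrite (bigD1 w) //= [X in _ + (_ + X)](bigD1 w) //=.
rewrite [f \in light _ _]inE [g \in light _ _]inE fs gt wof wog /=.
have : (w != hub f) || (w != hub g).
  by rewrite -negb_and; apply: contra Nh => /andP[/eqP <- /eqP <-].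
by move: (w != hub f) (w != hub g) => [] []; rewrite ?muln1 ?add0n ?add1n ?addSn ?addnS.
Qed.

(** An edge [f] of [meets_off t] has a single vertex [w] outside [e], and [w]
    determines [f].  So an edge of [meets_at t], with its two outside vertices,
    is adjacent to at most two such [f]. *)
Lemma line_adj_off t :
  \sum_(f in meets_off t) \sum_(g in meets_at t) line_adj f g
    <= 2 * #|meets_at t|.
Proof.
rewrite exchange_big /= mulnC -sum_nat_const; apply: leq_sum => g gt.
have [_ te] := meets_atP gt.
rewrite -(card_outside (meets_at_spoke gt)).
rewrite -card_sum_bool.
pose B : {set hedge H * hvertex H} :=
  [set p | [&& p.1 \in meets_off t, p.2 \in outside g & p.2 \in outside p.1]].
have inj2 : {in B &, injective snd}.
  move=> [f w] [f' w']; rewrite !inE /= => /and3P[Ef /andP[wNe _] /andP[_ wf]].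
  move=> /and3P[Ef' _ /andP[_ wf']] Ew; rewrite -{}Ew in wf' *; congr (_, _).
  apply: (@edge_unique (w |: (ends e :\ t))).
  - rewrite cardsU1 !inE (negPf wNe) andbF /=.
    by have := cardsD1 t (ends e); rewrite te H3; lia.
  - by rewrite subUset sub1set wf -(eqP Ef) subsetIl.
  - by rewrite subUset sub1set wf' -(eqP Ef') subsetIl.
apply: (@leq_trans #|B|); last first.
  rewrite -(card_in_imset inj2); apply: subset_leq_card.
  by apply/subsetP => w /imsetP[p]; rewrite inE => /and3P[_ ? _] ->.
apply: leq_trans (leq_imset_card fst _).
apply: subset_leq_card; apply/subsetP => f; rewrite in_set => /andP[fo].
case/andP => _ /set0Pn[w]; rewrite in_setI => /andP[wf wg].
have wNe : w \notin ends e.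
  apply/negP => we.
  have /eqP Ef : ends f :&: ends e == ends e :\ t by rewrite inE in fo.
  have /eqP Eg : ends g :&: ends e == [set t] by rewrite inE in gt.
  have : w \in ends f :&: ends e by rewrite inE wf.
  have : w \in ends g :&: ends e by rewrite inE wg.
  by rewrite Ef Eg !inE => ->.
apply/imsetP; exists (f, w) => //.
by rewrite in_set /= fo !in_setD wNe wf wg.
Qed.

(** * Degree, non-adjacent pairs and non-adjacent triples *)

Variables x y z : hvertex H.
Hypotheses (xy : x != y) (xz : x != z) (yz : y != z).
Hypothesis eE : ends e = [set x; y; z].

(** This and the next lemmas turn membership in the classes into Boolean
    formulas in the three incidences of an edge with [x], [y] and [z], so that
    identities and exclusions between classes follow by case analysis. *)
Lemma trace_eq f A : A \subset ends e ->
  (ends f :&: ends e == A) =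
  [&& (x \in ends f) == (x \in A), (y \in ends f) == (y \in A)
    & (z \in ends f) == (z \in A)].
Proof.
move=> Ae; apply/eqP/and3P => [<-|[/eqP Ex /eqP Ey /eqP Ez]].
  by rewrite eE !inE !eqxx !orbT !andbT !eqxx.
apply/setP => w; rewrite inE.
have [we|] := boolP (w \in ends e); last first.
  by move=> wNe; rewrite andbF; apply/esym/negP => /(subsetP Ae); apply/negP.
by move: we; rewrite andbT eE !inE -orbA => /or3P[]/eqP->.
Qed.

Lemma meets_atE f :
  (((f \in meets_at x) = [&& x \in ends f, y \notin ends f & z \notin ends f]) *
   ((f \in meets_at y) = [&& x \notin ends f, y \in ends f & z \notin ends f]) *
   ((f \in meets_at z) = [&& x \notin ends f, y \notin ends f & z \in ends f]))%type.
Proof.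
have yx : y != x by rewrite eq_sym.
have zx : z != x by rewrite eq_sym.
have zy : z != y by rewrite eq_sym.
split; [split|]; rewrite inE trace_eq ?sub1set ?eE ?inE ?eqxx ?orbT //.
all: rewrite ?(negPf xy) ?(negPf xz) ?(negPf yx) ?(negPf yz) ?(negPf zx) ?(negPf zy).
all: by do !case: (_ \in _).
Qed.

Lemma meets_offE f :
  (((f \in meets_off x) = [&& x \notin ends f, y \in ends f & z \in ends f]) *
   ((f \in meets_off y) = [&& x \in ends f, y \notin ends f & z \in ends f]) *
   ((f \in meets_off z) = [&& x \in ends f, y \in ends f & z \notin ends f]))%type.
Proof.
have yx : y != x by rewrite eq_sym.
have zx : z != x by rewrite eq_sym.
have zy : z != y by rewrite eq_sym.
split; [split|]; rewrite inE trace_eq ?subsetDl // eE !inE ?eqxx ?orbT.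
all: rewrite ?(negPf xy) ?(negPf xz) ?(negPf yx) ?(negPf yz) ?(negPf zx) ?(negPf zy).
all: by do !case: (_ \in _).
Qed.

Definition meetsE f := (meets_atE f, meets_offE f).

Lemma line_adj_eE f : line_adj e f =
  [|| x \in ends f, y \in ends f | z \in ends f]
  && ~~ [&& x \in ends f, y \in ends f & z \in ends f].
Proof.
have Ee : (e == f) = [&& x \in ends f, y \in ends f & z \in ends f].
  apply/eqP/and3P => [<-|[xf yf zf]]; first by rewrite eE !inE !eqxx !orbT.
  apply: (@edge_unique (ends e)); rewrite ?H3 //.
  by rewrite eE !subUset !sub1set xf yf.
rewrite /line_adj Ee andbC; congr (_ && _).
rewrite setIC trace_eq ?sub0set // !inE.
by do !case: (_ \in _).
Qed.

(** The six classes partition the neighbourhood of [e]. *)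
Lemma degree_meets : degree (e : line_graph H) =
  #|meets_at x| + #|meets_at y| + #|meets_at z|
  + (#|meets_off x| + #|meets_off y| + #|meets_off z|).
Proof.
rewrite /degree /nbhd card_nsum_bool.
rewrite !card_sum_mem -!big_split /=; apply: eq_bigr => f _.
rewrite !(meetsE f) line_adj_eE.
by do !case: (_ \in _).
Qed.

Lemma meets_hdegree :
  [/\ #|meets_at x| + #|meets_off y| + #|meets_off z| <= D,
      #|meets_at y| + #|meets_off x| + #|meets_off z| <= D &
      #|meets_at z| + #|meets_off x| + #|meets_off y| <= D].
Proof.
split; [apply: leq_trans (hdegree_le x)|apply: leq_trans (hdegree_le y)
  |apply: leq_trans (hdegree_le z)].
all: rewrite /hdegree card_nsum_bool !card_sum_mem -!big_split /=; apply: leq_sum => f _.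
all: rewrite !(meetsE f).
all: by do !case: (_ \in _).
Qed.

Definition nonadj_between (A B : {set hedge H}) :=
  \sum_(f in A) \sum_(g in B) ~~ line_adj f g.

Lemma nonadj_betweenE (A B : {set hedge H}) :
  nonadj_between A B + \sum_(f in A) \sum_(g in B) line_adj f g = #|A| * #|B|.
Proof.
rewrite -big_split /= -sum_nat_const; apply: eq_bigr => f _.
rewrite -big_split /= -[RHS]muln1 -sum_nat_const; apply: eq_bigr => g _.
by case: line_adj.
Qed.

(** The ordered pairs counted on the left are those in a fixed one of the two
    possible orders, so that passing to the unordered pair is injective; the
    omitted combinations of classes share a vertex of [e]. *)
Lemma nonadj_pairs_ge :
  nonadj_between (meets_at x) (meets_at y)
  + nonadj_between (meets_at y) (meets_at z)
  + nonadj_between (meets_at x) (meets_at z)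
  + (nonadj_between (meets_off x) (meets_at x)
     + nonadj_between (meets_off y) (meets_at y)
     + nonadj_between (meets_off z) (meets_at z))
    <= nonadj_pairs (e : line_graph H).
Proof.
pose R f g := [|| (f \in meets_at x) && (g \in meets_at y),
  (f \in meets_at y) && (g \in meets_at z), (f \in meets_at x) && (g \in meets_at z),
  (f \in meets_off x) && (g \in meets_at x), (f \in meets_off y) && (g \in meets_at y)
  | (f \in meets_off z) && (g \in meets_at z)].
pose Q := [set p : hedge H * hedge H | R p.1 p.2 && ~~ line_adj p.1 p.2].
have Rasym f g : R f g -> ~~ R g f.
  rewrite /R !(meetsE f) !(meetsE g).
  by do !case: (_ \in _).
have RN f g : R f g -> [&& f != g, line_adj e f & line_adj e g].
  move=> Rfg; apply/andP; split.
    by apply/eqP => E; have := Rasym _ _ Rfg; rewrite -E in Rfg *; rewrite Rfg.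
  move: Rfg; rewrite /R !line_adj_eE !(meetsE f) !(meetsE g).
  by do !case: (_ \in _).
pose pr (p : hedge H * hedge H) : {set line_graph H} := [set p.1; p.2].
have pr_inj : {in Q &, injective pr}.
  move=> [f g] [f' g']; rewrite !inE /= => /andP[Rfg _] /andP[Rfg' _] E.
  have /set2P[/= Ef|/= Ef] : f \in pr (f', g') by rewrite -E set21.
    have /set2P[/= Eg|/= Eg] : g' \in pr (f, g) by rewrite E set22.
      by have /and3P[] := RN _ _ Rfg'; rewrite -Ef -Eg /= eqxx.
    by rewrite Ef Eg.
  have /set2P[/= Eg|/= Eg] : f' \in pr (f, g) by rewrite E set21.
    by have /and3P[] := RN _ _ Rfg'; rewrite -Ef -Eg /= eqxx.
  by have := Rasym _ _ Rfg; rewrite Ef -Eg /= Rfg'.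
rewrite nonadj_pairsE.
apply: (@leq_trans #|Q|); last first.
  rewrite -(card_in_imset pr_inj); apply: subset_leq_card.
  apply/subsetP => A /imsetP[[f g]]; rewrite [_ \in Q]inE /= => /andP[Rfg Nfg] ->.
  have /and3P[fg ef eg] := RN _ _ Rfg.
  rewrite inE cards2 fg subUset !sub1set !inE /= ef eg /=.
  have Ngf : ~~ line_adj g f by rewrite line_adj_sym.
  apply/forall_inP => a /set2P[]->; apply/forall_inP => b /set2P[]->;
    by rewrite ?eqxx //= ?Nfg ?Ngf ?implybT.
rewrite card_nsum_bool -(pair_bigA _ (fun f g => (R f g && ~~ line_adj f g) : nat)) /=.
have nbE (A B : {set hedge H}) : nonadj_between A B =
    \sum_f \sum_g [&& f \in A, g \in B & ~~ line_adj f g].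
  rewrite /nonadj_between big_mkcond; apply: eq_bigr => f _.
  case: (f \in A); last by rewrite big1.
  by rewrite big_mkcond; apply: eq_bigr => g _; case: (g \in B).
rewrite !nbE -!big_split /=; apply: leq_sum => f _.
rewrite -!big_split /=; apply: leq_sum => g _.
rewrite /R !(meetsE f) !(meetsE g).
by case: line_adj; rewrite ?andbF //; do !case: (_ \in _).
Qed.

Lemma nonadj_hub f g s t : f \in meets_at s -> g \in meets_at t -> f != g ->
  ~~ line_adj f g -> hub f != hub g.
Proof.
move=> fs gt fg; rewrite /line_adj fg /= negbK; apply: contraTneq => E.
apply/set0Pn; exists (hub f); rewrite inE {2}E.
have /setDP[-> _] := hub_outside (meets_at_spoke fs).
by have /setDP[-> _] := hub_outside (meets_at_spoke gt).
Qed.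

(** Three pairwise disjoint edges that all meet the three-element set [e] each
    meet it in exactly one vertex.  Non-adjacent edges have distinct hubs. *)
Lemma nonadj_triples_le : nonadj_triples (e : line_graph H) <=
  \sum_(f in meets_at x) \sum_(g in meets_at y) \sum_(h in meets_at z)
    [&& hub f != hub g, hub g != hub h & hub f != hub h].
Proof.
pose Q := [set p : hedge H * hedge H * hedge H |
  [&& p.1.1 \in meets_at x, p.1.2 \in meets_at y, p.2 \in meets_at z,
      hub p.1.1 != hub p.1.2, hub p.1.2 != hub p.2 & hub p.1.1 != hub p.2]].
apply: (@leq_trans #|Q|); last first.
  rewrite card_nsum_bool.
  rewrite -(pair_bigA _ (fun p h =>
      [&& p.1 \in meets_at x, p.2 \in meets_at y, h \in meets_at z,
      hub p.1 != hub p.2, hub p.2 != hub h & hub p.1 != hub h] : nat)) /=.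
  rewrite -(pair_bigA _ (fun f g =>
      \sum_h ([&& f \in meets_at x, g \in meets_at y, h \in meets_at z,
      hub f != hub g, hub g != hub h & hub f != hub h] : nat))) /=.
  rewrite [leqRHS]big_mkcond; apply: leq_sum => f _.
  case: (f \in _); last by rewrite big1 // => g _; rewrite big1.
  rewrite [leqRHS]big_mkcond; apply: leq_sum => g _; case: (g \in _); last by rewrite big1.
  by rewrite [leqRHS]big_mkcond; apply: leq_sum => h _; case: (h \in _).
pose tr (p : hedge H * hedge H * hedge H) : {set line_graph H} := [set p.1.1; p.1.2; p.2].
apply: leq_trans (leq_imset_card tr Q).
apply: subset_leq_card; apply/subsetP => A; rewrite inE => /and3P[AN A3 /forall_inP nA].
have [a [b [c [ab ac bc EA]]]] := card3P (eqP A3).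
have aA : a \in A by rewrite EA !inE eqxx.
have bA : b \in A by rewrite EA !inE eqxx orbT.
have cA : c \in A by rewrite EA !inE eqxx orbT.
have nadj (u v : hedge H) : u \in A -> v \in A -> u != v -> ~~ line_adj u v.
  by move=> uA vA uv; have /forall_inP/(_ v vA) := nA u uA; rewrite uv.
have disj (u v : hedge H) w : u \in A -> v \in A -> u != v ->
    ~~ ((w \in ends u) && (w \in ends v)).
  move=> uA vA uv; have := nadj u v uA vA uv; rewrite /line_adj uv /= negbK => /eqP E.
  by have := in_set0 w; rewrite -E inE => ->.
have hit (u : hedge H) : u \in A -> [|| x \in ends u, y \in ends u | z \in ends u].
  by move/(subsetP AN); rewrite inE /= line_adj_eE => /andP[].
suff [f [g [h [fx gy hz EA']]]] : exists f g h,
    [/\ f \in meets_at x, g \in meets_at y, h \in meets_at z & A = [set f; g; h]].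
  apply/imsetP; exists (f, g, h) => //.
  have fA : f \in A by rewrite EA' !inE eqxx.
  have gA : g \in A by rewrite EA' !inE eqxx orbT.
  have hA : h \in A by rewrite EA' !inE eqxx orbT.
  have ne s t (u v : hedge H) : s != t -> u \in meets_at s -> v \in meets_at t -> u != v.
    move=> st us vt; apply: contraNneq st => E.
    by move: us vt; rewrite E !inE => /eqP -> /eqP/set1_inj ->.
  rewrite inE /= fx gy hz /=; apply/and3P; split.
  - by apply: (nonadj_hub fx gy); last apply: nadj; rewrite // (ne _ _ _ _ _ fx gy).
  - by apply: (nonadj_hub gy hz); last apply: nadj; rewrite // (ne _ _ _ _ _ gy hz).
  - by apply: (nonadj_hub fx hz); last apply: nadj; rewrite // (ne _ _ _ _ _ fx hz).
(* Each of the three edges takes at least one vertex of [e] and no two of them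
   share one, so none can take two. *)
have own (u v w : hedge H) : u \in A -> v \in A -> w \in A ->
    u != v -> u != w -> v != w ->
    [\/ u \in meets_at x, u \in meets_at y | u \in meets_at z].
  move=> uA vA wA uv uw vw; apply/or3P; rewrite !(meets_atE u).
  have := hit u uA; have := hit v vA; have := hit w wA.
  have := disj u v x uA vA uv; have := disj u w x uA wA uw; have := disj v w x vA wA vw.
  have := disj u v y uA vA uv; have := disj u w y uA wA uw; have := disj v w y vA wA vw.
  have := disj u v z uA vA uv; have := disj u w z uA wA uw; have := disj v w z vA wA vw.
  case: (x \in ends u); case: (y \in ends u); case: (z \in ends u) => //=;
    case: (x \in ends v); case: (y \in ends v); case: (z \in ends v) => //=;
    by case: (x \in ends w); case: (y \in ends w); case: (z \in ends w).
have excl t (u v : hedge H) : u \in A -> v \in A -> u != v ->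
    u \in meets_at t -> v \in meets_at t -> False.
  move=> uA vA uv /meets_atP[tu _] /meets_atP[tv _].
  by have := disj u v t uA vA uv; rewrite tu tv.
have Oa := own a b c aA bA cA ab ac bc.
have ba : b != a by rewrite eq_sym.
have ca : c != a by rewrite eq_sym.
have cb : c != b by rewrite eq_sym.
have Ob := own b a c bA aA cA ba bc ac.
have Oc := own c a b cA aA bA ca cb ab.
case: Oa => Oa; case: Ob => Ob; try (by case: (excl _ a b aA bA ab Oa Ob));
  case: Oc => Oc; try by [case: (excl _ a c aA cA ac Oa Oc)
                           | case: (excl _ b c bA cA bc Ob Oc)].
- by exists a, b, c; split.
- by exists a, c, b; split; rewrite // EA setUAC.
- by exists b, a, c; split; rewrite // EA [[set b] :|: _]setUC.
- by exists c, a, b; split; rewrite // EA setUAC [[set a] :|: _]setUC.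
- by exists b, c, a; split; rewrite // EA [[set a] :|: _]setUC setUAC.
- by exists c, b, a; split; rewrite // EA setUAC [[set a] :|: _]setUC setUAC.
Qed.

(** * Pairs and triples with a common hub *)

Definition hub_count t w := #|[set f in meets_at t | hub f == w]|.
Definition same_hub3 :=
  \sum_(f in meets_at x) \sum_(g in meets_at y) \sum_(h in meets_at z)
    ((hub f == hub g) && (hub g == hub h)).

Lemma sum_eq_hub f (F : hvertex H -> nat) : \sum_w (hub f == w) * F w = F (hub f).
Proof.
rewrite (bigD1 (hub f)) //= eqxx mul1n big1 ?addn0 // => w.
by rewrite eq_sym => /negPf->.
Qed.

Lemma same_hubE s t : same_hub s t = \sum_w hub_count s w * hub_count t w.
Proof.
rewrite /same_hub.
under [RHS]eq_bigr do rewrite {1}/hub_count card_sum_bool big_distrl /=.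
rewrite [RHS]exchange_big /=; apply: eq_bigr => f _.
rewrite sum_eq_hub /hub_count card_sum_bool.
by apply: eq_bigr => g _; rewrite eq_sym.
Qed.

Lemma same_hub3E :
  same_hub3 = \sum_w hub_count x w * (hub_count y w * hub_count z w).
Proof.
rewrite /same_hub3.
under [RHS]eq_bigr do rewrite {1}/hub_count card_sum_bool big_distrl /=.
rewrite [RHS]exchange_big /=; apply: eq_bigr => f _.
rewrite sum_eq_hub /hub_count card_sum_bool big_distrl /=.
apply: eq_bigr => g _; rewrite card_sum_bool big_distrr /=.
apply: eq_bigr => h _; rewrite [hub g == _]eq_sym.
by rewrite mulnb [hub f == _]eq_sym; case: (hub g =P hub f) => [->|].
Qed.

Lemma sum_hub_count t : \sum_w hub_count t w = #|meets_at t|.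
Proof.
under eq_bigr do rewrite /hub_count card_sum_bool.
rewrite exchange_big /= -sum1_card; apply: eq_bigr => f _.
by under eq_bigr do rewrite -[X in nat_of_bool X]andbT -mulnb;
  rewrite (sum_eq_hub f (fun=> 1)).
Qed.

(** The edges with hub [w] all contain [w]. *)
Lemma hub_count_le w : hub_count x w + hub_count y w + hub_count z w <= D.
Proof.
apply: leq_trans (leq_trans (load_le_hdegree w) (hdegree_le w)).
rewrite /hub_count /load !card_nsum_bool -!big_split /=; apply: leq_sum => f _.
have [fF|fNF] := boolP (f \in spokes); last first.
  have Nat t : f \in meets_at t = false.
    by apply: contraNF fNF; apply: meets_at_spoke.
  by rewrite !Nat.
case: eqP => [<-|_]; last by rewrite !andbF.
by rewrite (hub_outside fF) !andbT !(meets_atE f); do !case: (_ \in _).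
Qed.

Lemma sum_hub_counts :
  \sum_w (hub_count x w + hub_count y w + hub_count z w) <= 3 * D.
Proof.
rewrite !big_split /= !sum_hub_count; have [] := meets_hdegree; lia.
Qed.

(** With [p], [q], [r] the three numbers of edges with hub [w], the
    contribution [p * q + q * r + p * r] of [w] is at most a third of
    [(p + q + r) ^ 2], hence of [D * (p + q + r)], and the numbers
    [p + q + r] sum to at most [3 * D]. *)
Lemma same_hub_le : same_hub x y + same_hub y z + same_hub x z <= D ^ 2.
Proof.
rewrite -(leq_pmul2l (ltn0Sn 2)).
apply: (@leq_trans (D * (3 * D))); last by rewrite -mulnn; lia.
apply: leq_trans (leq_mul (leqnn D) sum_hub_counts).
rewrite !same_hubE -!big_split /= !big_distrr /=; apply: leq_sum => w _.
apply: leq_trans (leq_mul (hub_count_le w) (leqnn _)).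
exact: amgm2.
Qed.

(** As for pairs, from [27 * p * q * r <= (p + q + r) ^ 3]. *)
Lemma same_hub3_le : 9 * same_hub3 <= D ^ 3.
Proof.
rewrite -(leq_pmul2l (ltn0Sn 2)).
apply: (@leq_trans (D ^ 2 * (3 * D))); last by rewrite !expnS expn0; lia.
apply: leq_trans (leq_mul (leqnn _) sum_hub_counts).
rewrite same_hub3E mulnA !big_distrr /=; apply: leq_sum => w _.
apply: leq_trans (amgm3 _ _ _) _.
by rewrite expnSr leq_mul // leq_exp2r // hub_count_le.
Qed.

(** Inclusion and exclusion over the three coincidences of hubs; any two of them
    imply the third, so three terms occur where the three edges have the same
    hub, whence the factor 2. *)
Lemma nonadj_triples_hub :
  nonadj_triples (e : line_graph H) + same_hub x y * #|meets_at z|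
    + same_hub y z * #|meets_at x| + same_hub x z * #|meets_at y|
  <= #|meets_at x| * (#|meets_at y| * #|meets_at z|) + 2 * same_hub3.
Proof.
have Exy : same_hub x y * #|meets_at z| = \sum_(f in meets_at x)
    \sum_(g in meets_at y) \sum_(h in meets_at z) (hub f == hub g).
  rewrite big_distrl; apply: eq_bigr => f _; rewrite big_distrl; apply: eq_bigr => g _.
  by rewrite sum_nat_const mulnC.
have Exz : same_hub x z * #|meets_at y| = \sum_(f in meets_at x)
    \sum_(g in meets_at y) \sum_(h in meets_at z) (hub f == hub h).
  rewrite big_distrl; apply: eq_bigr => f _.
  by rewrite /= sum_nat_const mulnC.
have Eyz : same_hub y z * #|meets_at x| = \sum_(f in meets_at x)
    \sum_(g in meets_at y) \sum_(h in meets_at z) (hub g == hub h).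
  by rewrite sum_nat_const mulnC.
have Exyz : #|meets_at x| * (#|meets_at y| * #|meets_at z|) = \sum_(f in meets_at x)
    \sum_(g in meets_at y) \sum_(h in meets_at z) 1.
  by rewrite !sum_nat_const muln1.
have E3 : 2 * same_hub3 = \sum_(f in meets_at x)
    \sum_(g in meets_at y) \sum_(h in meets_at z) 2 * ((hub f == hub g) && (hub g == hub h)).
  rewrite big_distrr; apply: eq_bigr => f _; rewrite big_distrr; apply: eq_bigr => g _.
  by rewrite big_distrr.
rewrite Exy Exz Eyz Exyz E3 -!addnA; apply: leq_trans (leq_add nonadj_triples_le (leqnn _)) _.
rewrite -!big_split /=; apply: leq_sum => f _.
rewrite -!big_split /=; apply: leq_sum => g _.
rewrite -!big_split /=; apply: leq_sum => h _.
case: (hub f =P hub g) => [->|fg]; first by case: (hub g == hub h).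
case: (hub g =P hub h) => [<-|gh]; last by case: (hub f == hub h).
by case: eqP.
Qed.

Definition light_total := light_pairs x + light_pairs y + light_pairs z.

(** The error [6 * D] collects the adjacent pairs between [meets_off t] and
    [meets_at t], at most [2 * D] for each [t]. *)
Lemma nonadj_pairs_hub :
  #|meets_at x| * #|meets_at y| + #|meets_at y| * #|meets_at z|
    + #|meets_at x| * #|meets_at z|
    + (#|meets_off x| * #|meets_at x| + #|meets_off y| * #|meets_at y|
       + #|meets_off z| * #|meets_at z|)
  <= nonadj_pairs (e : line_graph H)
     + (same_hub x y + same_hub y z + same_hub x z) + (2 * light_total + 6 * D).
Proof.
have := nonadj_pairs_ge; rewrite -!nonadj_betweenE.
have := line_adj_meets xy; have := line_adj_meets yz; have := line_adj_meets xz.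
have := line_adj_off x; have := line_adj_off y; have := line_adj_off z.
have [] := meets_hdegree; rewrite /light_total; lia.
Qed.

End Neighbourhood.

(** * The extremal problem *)

Local Open Scope ring_scope.

(** Here [p], [q], [r] are the sizes of the classes [meets_at], [a], [b], [c]
    those of the opposite classes [meets_off], and [Spq], [Sqr], [Spr], [t] the
    numbers of pairs and triples with a common hub, all normalised.  Write
    [u = 1 - p], [v = 1 - q], [w = 1 - r].  Multiplied by 27, the left side is
    [6(a+b+c) + 3(au+bv+cw) + 19 - 4(u+v+w) - 2(uv+vw+uw) - uvw
     + 2(Spq+Sqr+Spr) + (Spq w + Sqr u + Spr v) + 2t].
    Now [6(a+b+c) <= 3(u+v+w)] by the degree bounds,
    [3(au+bv+cw) <= 2(uv+vw+uw)], and [Spq w + Sqr u + Spr v <= u+v+w], so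
    that the terms in [u], [v], [w] cancel, and [19 + 2 + 2/9] remains. *)
Lemma local_density (R : realFieldType) (p q r a b c Spq Sqr Spr t : R) :
  0 <= p -> 0 <= q -> 0 <= r -> 0 <= a -> 0 <= b -> 0 <= c ->
  p + b + c <= 1 -> q + a + c <= 1 -> r + a + b <= 1 ->
  0 <= Spq -> 0 <= Sqr -> 0 <= Spr -> Spq + Sqr + Spr <= 1 -> 9 * t <= 1 ->
  (p + q + r + (a + b + c)) / 3
  - (p * q + q * r + p * r + (a * p + b * q + c * r) - (Spq + Sqr + Spr)) / 9
  + (p * (q * r) + 2 * t - Spq * r - Sqr * p - Spr * q) / 27
  <= 1 - 2 / 9 + 2 / 3 ^+ 5.
Proof.
move=> p0 q0 r0 a0 b0 c0 px qx rx Spq0 Sqr0 Spr0 S1 t1.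
pose u := 1 - p; pose v := 1 - q; pose w := 1 - r.
have u0 : b + c <= u by rewrite /u; lra.
have v0 : a + c <= v by rewrite /v; lra.
have w0 : a + b <= w by rewrite /w; lra.
(* In terms of the slacks [u'], [v'], [w'] of the degree bounds, the difference
   of the two sides is a polynomial with nonnegative coefficients. *)
have off : 3 * (a * u + b * v + c * w) <= 2 * (u * v + v * w + u * w).
  pose u' := u - b - c; pose v' := v - a - c; pose w' := w - a - b.
  have u'0 : 0 <= u' by rewrite /u'; lra.
  have v'0 : 0 <= v' by rewrite /v'; lra.
  have w'0 : 0 <= w' by rewrite /w'; lra.
  have -> : u = u' + b + c by rewrite /u'; ring.
  have -> : v = v' + a + c by rewrite /v'; ring.
  have -> : w = w' + a + b by rewrite /w'; ring.
  have := mulr_ge0 u'0 v'0; have := mulr_ge0 v'0 w'0; have := mulr_ge0 u'0 w'0.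
  have := mulr_ge0 u'0 a0; have := mulr_ge0 u'0 b0; have := mulr_ge0 u'0 c0.
  have := mulr_ge0 v'0 a0; have := mulr_ge0 v'0 b0; have := mulr_ge0 v'0 c0.
  have := mulr_ge0 w'0 a0; have := mulr_ge0 w'0 b0; have := mulr_ge0 w'0 c0.
  have := sqr_ge0 a; have := sqr_ge0 b; have := sqr_ge0 c.
  nra.
have e3 : 0 <= u * v * w by rewrite !mulr_ge0 //; lra.
have Sw : Spq * w <= w by rewrite -[leRHS]mul1r ler_wpM2r //; lra.
have Su : Sqr * u <= u by rewrite -[leRHS]mul1r ler_wpM2r //; lra.
have Sv : Spr * v <= v by rewrite -[leRHS]mul1r ler_wpM2r //; lra.
have -> : p = 1 - u by rewrite /u; ring.
have -> : q = 1 - v by rewrite /v; ring.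
have -> : r = 1 - w by rewrite /w; ring.
rewrite (_ : 2 / 3 ^+ 5 = 2 / 243); last by field.
move: e3 Sw Su Sv off u0 v0 w0 S1 t1; clear; move: u v w => u v w; nra.
Qed.

Lemma local_density_scaled (R : realFieldType) (d p q r a b c Spq Sqr Spr t : R) :
  0 < d -> 0 <= p -> 0 <= q -> 0 <= r -> 0 <= a -> 0 <= b -> 0 <= c ->
  p + b + c <= d -> q + a + c <= d -> r + a + b <= d ->
  0 <= Spq -> 0 <= Sqr -> 0 <= Spr -> Spq + Sqr + Spr <= d ^+ 2 ->
  9 * t <= d ^+ 3 ->
  (p + q + r + (a + b + c)) / (3 * d)
  - (p * q + q * r + p * r + (a * p + b * q + c * r) - (Spq + Sqr + Spr)) / (3 * d) ^+ 2
  + (p * (q * r) + 2 * t - Spq * r - Sqr * p - Spr * q) / (3 * d) ^+ 3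
  <= 1 - 2 / 9 + 2 / 3 ^+ 5.
Proof.
move=> d0 p0 q0 r0 a0 b0 c0 px qx rx Spq0 Sqr0 Spr0 S1 t1.
have div0 u k : 0 <= u -> 0 <= u / d ^+ k.
  by move=> u0; rewrite divr_ge0 // exprn_ge0 // ltW.
have := @local_density R (p / d ^+ 1) (q / d ^+ 1) (r / d ^+ 1)
  (a / d ^+ 1) (b / d ^+ 1) (c / d ^+ 1)
  (Spq / d ^+ 2) (Sqr / d ^+ 2) (Spr / d ^+ 2) (t / d ^+ 3).
move=> /(_ (div0 _ _ p0) (div0 _ _ q0) (div0 _ _ r0)
  (div0 _ _ a0) (div0 _ _ b0) (div0 _ _ c0)).
rewrite -!(mulrDl _ _ (d ^+ 1)^-1) -!(mulrDl _ _ (d ^+ 2)^-1) (mulrA 9 t).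
rewrite 3!(ler_pdivrMr _ _ (d0 : 0 < d ^+ 1)).
rewrite !(ler_pdivrMr _ _ (exprn_gt0 _ d0)) !mul1r.
move=> /(_ px qx rx (div0 _ _ Spq0) (div0 _ _ Sqr0) (div0 _ _ Spr0) S1 t1).
apply: le_trans; rewrite le_eqVlt; apply/orP; left; apply/eqP.
by field; rewrite gt_eqF.
Qed.

(** * The asymptotic bound *)

Local Open Scope classical_set_scope.

Lemma cvg_inv_sqrt (R : realType) :
  (13 / Num.sqrt D%:R : R) @[D --> \oo] --> (0 : R).
Proof.
rewrite -[X in _ --> X](mulr0 13); apply: cvgMr.
under eq_fun do rewrite -sqrtrV //.
rewrite -(@sqrtr0 R); apply: continuous_cvg; first exact: sqrt_continuous.
rewrite -cvg_shiftS; exact: cvg_harmonic.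
Qed.

(** [light_sq] gives [#|light t w| <= sqrt (6D)], and [sqrt 6 <= 3]; the loads
    sum to at most [6D]. *)
Lemma light_pairs_le (R : rcfType) (H : hypergraph) (D : nat) (e : hedge H)
    (hub : hedge H -> hvertex H) (t : hvertex H) :
  uniform 3 H -> simple_hypergraph 2 H -> (max_hdegree H <= D)%N ->
  {in spokes e, forall f, is_hub e f (hub f)} ->
  (light_pairs e hub t)%:R <= 18 * Num.sqrt D%:R * D%:R :> R.
Proof.
move=> H3 H2 HD hubP.
apply: (@le_trans _ _ (\sum_w 3 * Num.sqrt D%:R * (load e w)%:R)).
  rewrite natr_sum; apply: ler_sum => w _; rewrite natrM ler_wpM2r //.
  rewrite -(@ler_pXn2r _ 2) ?nnegrE ?mulr_ge0 ?sqrtr_ge0 //.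
  rewrite exprMn sqr_sqrtr // -natrX.
  have := light_sq H3 H2 HD hubP t w; rewrite -(ler_nat R) natrM.
  by have : 0 <= D%:R :> R by []; lra.
rewrite -mulr_sumr -natr_sum.
have := sum_load e H3 HD; rewrite -(ler_nat R) natrM => le6.
apply: le_trans (ler_wpM2l _ le6) _; first by rewrite mulr_ge0 ?sqrtr_ge0.
by rewrite mulrA; lra.
Qed.

Theorem lemma3p2 (R : realType) :
  exists eps : nat -> R,
    eps D @[D --> \oo] --> (0 : R) /\
    forall (D : nat) (H : hypergraph),
      uniform 3 H -> simple_hypergraph 2 H -> (max_hdegree H <= D)%N ->
      forall e : hedge H,
        b_fun (G := line_graph H) (3 * D%:R : R) e
          <= 1 - 2 / 9 + 2 / 3 ^+ 5 + eps D.
Proof.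
exists (fun D => 13 / Num.sqrt D%:R); split; first exact: cvg_inv_sqrt.
move=> D H H3 H2 HD e.
have [x [y [z [xy xz yz eE]]]] := card3P (H3 e).
have [hub hubP] := hub_exists e H3.
have D_gt0 : (0 < D)%N.
  apply: leq_trans (hdegree_le HD x); apply/card_gt0P; exists e.
  by rewrite inE eE !inE eqxx.
have := light_pairs_le R x H3 H2 HD hubP.
have := light_pairs_le R y H3 H2 HD hubP.
have := light_pairs_le R z H3 H2 HD hubP.
have := nonadj_pairs_hub H3 H2 HD hub xy xz yz eE.
have := nonadj_triples_hub H3 H2 hubP xy xz yz eE.
have := same_hub3_le HD hubP xy xz yz eE.
have := same_hub_le HD hubP xy xz yz eE.
have [] := meets_hdegree HD xy xz yz eE.
rewrite /b_fun (degree_meets H3 H2 xy xz yz eE) /light_total.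
rewrite -!(ler_nat R) !(natrD, natrM, natrX).
set r := Num.sqrt D%:R.
have r1 : 1 <= r by rewrite -sqrtr1 ler_wsqrtr // ler1n.
have Er : D%:R = r ^+ 2 :> R by rewrite sqr_sqrtr.
have d0 : 0 < D%:R :> R by rewrite ltr0n.
have nat0 n : 0 <= n%:R :> R by [].
(* From here on only inequalities between real numbers matter, so the counts
   are replaced by real variables. *)
move: (nat0 #|meets_at e x|) (nat0 #|meets_at e y|) (nat0 #|meets_at e z|).
move: (nat0 #|meets_off e x|) (nat0 #|meets_off e y|) (nat0 #|meets_off e z|).
move: (nat0 (same_hub e hub x y)) (nat0 (same_hub e hub y z)).
move: (nat0 (same_hub e hub x z)).
move: (#|meets_at e x|%:R : R) (#|meets_at e y|%:R : R) (#|meets_at e z|%:R : R).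
move: (#|meets_off e x|%:R : R) (#|meets_off e y|%:R : R) (#|meets_off e z|%:R : R).
move: ((same_hub e hub x y)%:R : R) ((same_hub e hub y z)%:R : R).
move: ((same_hub e hub x z)%:R : R) ((same_hub3 e hub x y z)%:R : R).
move: ((nonadj_pairs _)%:R : R) ((nonadj_triples _)%:R : R).
move: ((light_pairs _ _ x)%:R : R) ((light_pairs _ _ y)%:R : R) ((light_pairs _ _ z)%:R : R).
move: (D%:R : R) d0 Er => d d0 Er.
move=> lx ly lz P T Sxz t Sxy Syz a b c p q s.
move=> Sxz0 Sxy0 Syz0 a0 b0 c0 p0 q0 s0 pD qD sD S1 t1 Tle Ple lzle lyle lxle.
have main := local_density_scaled d0 p0 q0 s0 a0 b0 c0 pD qD sD Sxy0 Syz0 Sxz0 S1 t1.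
apply: le_trans (lerD main (lexx _)).
have M2 : 0 < ((3 * d) ^+ 2)^-1 by rewrite invr_gt0 exprn_gt0 // mulr_gt0.
have M3 : 0 < ((3 * d) ^+ 3)^-1 by rewrite invr_gt0 exprn_gt0 // mulr_gt0.
(* The two errors are [2 * light_total <= 108 * r * d] and
   [6 * d <= 6 * r * d], where [r = sqrt d]. *)
have err : (114 * r * d) / (3 * d) ^+ 2 <= 13 / r.
  have r0 : r != 0 by rewrite gt_eqF // (lt_le_trans ltr01).
  have -> : 114 * r * d / (3 * d) ^+ 2 = (114 / 9) / r by rewrite Er; field.
  by rewrite ler_wpM2r ?invr_ge0 ?sqrtr_ge0 //; lra.
have rd : d <= r * d by rewrite ler_peMl // ltW.
have {}Ple : p * q + q * s + p * s + (a * p + b * q + c * s) - (Sxy + Syz + Sxz)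
    <= P + 114 * r * d by lra.
have {}Tle : T <= p * (q * s) + 2 * t - Sxy * s - Syz * p - Sxz * q by lra.
have := ler_wpM2r (ltW M3) Tle; have := ler_wpM2r (ltW M2) Ple; move: err.
rewrite (mulrDl P); lra.
Qed.
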